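(* Let $\Omega$ be a Jordan domain in $\mathbb{C}$. Consider the sets $X_1(\Omega)=\{f\in A(\Omega):$ the antiderivative of $f$ does not belong to $H^\infty(\Omega)\}$, $X_2(\Omega)=\{f\in A(\Omega):$ the antiderivative of $f$ does not belong to $A(\Omega)\}$, $X_3(\Omega)=\{f\in H^\infty(\Omega):$ the antiderivative of $f$ does not belong to $H^\infty(\Omega)\}$, $X_4(\Omega)=\{f\in H^\infty(\Omega):$ the antiderivative of $f$ does not belong to $A(\Omega)\}$. Then: (i) if $X_1(\Omega)\neq\emptyset$, then $X_1(\Omega)$ is dense and $G_\delta$ in $A(\Omega)$ and $X_2(\Omega)$ is residual in $A(\Omega)$; (ii) if $X_3(\Omega)\neq\emptyset$, then $X_3(\Omega)$ is dense and $G_\delta$ in $H^\infty(\Omega)$ and $X_4(\Omega)$ is residual in $H^\infty(\Omega)$.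
   Context: A Jordan domain is the bounded domain enclosed by a Jordan (simple closed) curve in $\mathbb{C}$. $H^\infty(\Omega)$ is the space of bounded holomorphic functions on $\Omega$, and $A(\Omega)$ is the space of functions holomorphic on $\Omega$ which extend continuously to $\overline{\Omega}$; both are endowed with the topology of the supremum norm on $\Omega$. An antiderivative of $f$ on $\Omega$ is a holomorphic $F$ on $\Omega$ with $F'=f$; it is unique up to an additive constant, which does not affect membership in these spaces. A set is residual if it contains a dense $G_\delta$ set. *)

(* Defs.v *)
From HB Require Import structures.
From mathcomp Require Import all_boot all_order all_algebra.
From mathcomp Require Import complex.
From mathcomp Require Import all_classical all_reals all_analysis.
From mathcomp Require Import borel_hierarchy.

Set Implicit Arguments.
Unset Strict Implicit.
Unset Printing Implicit Defensive.

Import Order.TTheory GRing.Theory Num.Theory.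
Import numFieldNormedType.Exports.

Local Open Scope classical_set_scope.
Local Open Scope ring_scope.

(* The regular module R[i]^o carries the topology of the modulus and has
   scalar field R[i], so that [derivable f z 1] below is complex
   differentiability of f at z. *)
Notation Cplx R := (R[i]^o).

Definition residual (T : topologicalType) (S : set T) : Prop :=
  exists D : set T, [/\ dense D, Gdelta D & D `<=` S].

Definition jordan_curve (R : realType) (gamma : R -> Cplx R) : Prop :=
  [/\ {within `[0, 1], continuous gamma},
      gamma 0 = gamma 1 &
      {in `[0, 1[ &, injective gamma}].

(* The domain enclosed by the curve is the bounded connected component of the
   complement of its trace. *)
Definition jordan_domain (R : realType) (Omega : set (Cplx R)) : Prop :=
  exists (gamma : R -> Cplx R) (z : Cplx R),
    [/\ jordan_curve gamma,
        (~` (gamma @` `[0, 1])) z,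
        Omega = connected_component (~` (gamma @` `[0, 1])) z &
        bounded_set Omega].

(* Functions on Omega are represented by total functions vanishing outside
   Omega, so that distinct representatives are distinct functions on Omega. *)
Definition fun_on (R : realType) (Omega : set (Cplx R))
    (f : Cplx R -> Cplx R) : Prop :=
  forall z, ~ Omega z -> f z = 0.

Definition holomorphic_on (R : realType) (Omega : set (Cplx R))
    (f : Cplx R -> Cplx R) : Prop :=
  forall z, Omega z -> derivable f z 1.

(* {uniform` Omega -> _} carries the topology of uniform convergence on Omega;
   [nbhs_supnorm] below shows that the topology it induces on a subset S is
   that of the supremum norm on Omega. *)
Definition Hinfty (R : realType) (Omega : set (Cplx R)) :
    set {uniform` Omega -> Cplx R} :=
  [set f : Cplx R -> Cplx R |
    [/\ fun_on Omega f, holomorphic_on Omega f &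
        [bounded f z | z in Omega]]].
Arguments Hinfty {R} Omega _.

Definition Abar (R : realType) (Omega : set (Cplx R)) :
    set {uniform` Omega -> Cplx R} :=
  [set f : Cplx R -> Cplx R |
    [/\ fun_on Omega f, holomorphic_on Omega f &
        exists2 g : Cplx R -> Cplx R,
          {within closure Omega, continuous g} &
          forall z, Omega z -> g z = f z]].
Arguments Abar {R} Omega _.

Definition supnorm (R : realType) (Omega : set (Cplx R))
    (f : Cplx R -> Cplx R) : \bar R :=
  ereal_sup [set (complex.Re `|f z|)%:E | z in Omega].

Lemma nbhs_supnorm (R : realType) (Omega : set (Cplx R))
    (S : set {uniform` Omega -> Cplx R}) (f : set_type S)
    (U : set (set_type S)) :
  nbhs f U <-> exists2 e : R, 0 < e &
    forall g : set_type S,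
      (supnorm Omega (fun z => (set_val g : Cplx R -> Cplx R) z
                               - (set_val f : Cplx R -> Cplx R) z)%R
       < e%:E)%E -> U g.
Proof.
have e0E (e : Cplx R) : 0 < e -> 0 < complex.Re e /\ e = (complex.Re e)%:C%C.
  by case: e => a b; rewrite ltcE /= => /andP[/eqP -> ->].
have nrmE (z : Cplx R) : `|z| = (complex.Re `|z|)%:C%C.
  by case: z => a b.
split.
- case=> W [[V oV VW] /= Wf WU].
  have Vf : V (set_val f) by have : (set_val @^-1` V) f by rewrite VW.
  have /uniform_nbhs[E [entE EV]] := open_nbhs_nbhs (conj oV Vf).
  move: entE; rewrite -entourage_ballE => -[e /= e0 eE].
  have [Re0 Ee] := e0E _ e0.
  exists (complex.Re e) => // g ge; apply: WU; rewrite -VW.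
  apply: EV => z Oz /=.
  apply: eE => /=; rewrite -ball_normE /= distrC nrmE Ee ltcR -lte_fin.
  by apply: le_lt_trans ge; apply: ereal_sup_ubound; exists z.
- case=> e e0 eU.
  pose E := [set xy : Cplx R * Cplx R | ball xy.1 ((e / 2)%:C%C : Cplx R) xy.2].
  have entE : entourage E.
    rewrite -entourage_ballE; exists ((e / 2)%:C%C) => //=.
    by rewrite ltcR divr_gt0.
  have fE : nbhs (set_val f) [set h : {uniform` Omega -> Cplx R} |
      forall z, Omega z -> E ((set_val f : Cplx R -> Cplx R) z,
                              (h : Cplx R -> Cplx R) z)].
    by apply/uniform_nbhs; exists E; split.
  have := @initial_continuous (set_type S) _ set_val f _ fE.
  apply: (@filterS _ (nbhs f) _) => g /= gE.
  apply: eU; apply: (@le_lt_trans _ _ (e / 2)%:E).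
    apply: ge_ereal_sup => _ [z Oz <-]; rewrite lee_fin -lecR -nrmE.
    by move: (gE z Oz); rewrite /E /= -ball_normE /= distrC => /ltW.
  by rewrite lte_fin gtr_pMr// invf_lt1// ltr1n.
Qed.

Definition antiderivative (R : realType) (Omega : set (Cplx R))
    (f F : Cplx R -> Cplx R) : Prop :=
  fun_on Omega F /\ forall z, Omega z -> is_derive z (1 : Cplx R) F (f z).

(* An antiderivative on the domain Omega is unique up to an additive constant,
   and Hinfty and Abar are stable under adding constants on Omega, so "the
   antiderivative of f is not in the space" is the statement that no
   antiderivative of f is. *)
Definition X1 (R : realType) (Omega : set (Cplx R)) :
    set (set_type (Abar Omega)) :=
  [set f | forall F, antiderivative Omega (set_val f) F -> ~ Hinfty Omega F].

Definition X2 (R : realType) (Omega : set (Cplx R)) :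
    set (set_type (Abar Omega)) :=
  [set f | forall F, antiderivative Omega (set_val f) F -> ~ Abar Omega F].

Definition X3 (R : realType) (Omega : set (Cplx R)) :
    set (set_type (Hinfty Omega)) :=
  [set f | forall F, antiderivative Omega (set_val f) F -> ~ Hinfty Omega F].

Definition X4 (R : realType) (Omega : set (Cplx R)) :
    set (set_type (Hinfty Omega)) :=
  [set f | forall F, antiderivative Omega (set_val f) F -> ~ Abar Omega F].

Arguments X1 {R} Omega _.
Arguments X2 {R} Omega _.
Arguments X3 {R} Omega _.
Arguments X4 {R} Omega _.

(* Main.v *)
(* Write X for the set of f in A or H^infty without a bounded antiderivative.
   Its complement is the union over n of the sets C_n of the f having an
   antiderivative with values in the square [-n, n]^2.  Each C_n is closed: for
   f in its closure, choose an ultrafilter on C_n converging to f and take the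
   pointwise limit of the antiderivatives along it, which exists because the
   square is compact; by the mean value inequality on discs, uniform
   convergence of the derivatives makes this limit an antiderivative of f.
   Hence X is a G_delta.  The complement of X is a vector space: if f is not in
   X and f0 is, then f + c f0 is in X for all c <> 0, so X is dense.  Finally,
   functions in A are bounded because the closure of Omega is compact, so
   X1 is contained in X2 and X3 in X4. *)
Require Import Defs.
From mathcomp Require Import all_boot all_order all_algebra.
From mathcomp Require Import complex.
From mathcomp Require Import all_classical all_reals all_analysis.
From mathcomp Require Import borel_hierarchy.
From mathcomp Require Import ring.

Set Implicit Arguments.
Unset Strict Implicit.
Unset Printing Implicit Defensive.

Import Order.TTheory GRing.Theory Num.Theory.
Import numFieldNormedType.Exports.

Local Open Scope classical_set_scope.
Local Open Scope ring_scope.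

(** * Differentiability as a first-order estimate *)

(** Multiplying the difference quotient by [h] gives an estimate that also holds at [h = 0] and can
    be added term by term. The field [K] is kept general because the estimate serves both over [R],
    for the real mean value theorem, and over [R[i]]. *)
Lemma is_derive1_nearP (K : numFieldType) (F : K^o -> K^o) (w l : K^o) :
  is_derive w (1 : K^o) F l <->
  forall e : K, 0 < e ->
    \forall h \near (0 : K^o), `|F (h + w) - F w - h * l| <= e * `|h|.
Proof.
have quotE (h : K) : h != 0 ->
    `|F (h + w) - F w - h * l| =
    `|l - h^-1 *: ((F \o shift w) (h *: (1 : K^o)) - F w)| * `|h|.
  move=> h0; rewrite -normrM mulrBl distrC /= /shift /= /GRing.scale /= mulr1.
  by rewrite [h^-1 * _]mulrC mulfVK// [l * h]mulrC.
split.
- case=> dF dFl e e0.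
  have /cvgrPdist_le/(_ e e0) : (fun h : K^o =>
      h^-1 *: ((F \o shift w) (h *: (1 : K^o)) - F w)) @ 0^' --> l.
    by rewrite -dFl; exact: dF.
  move=> H; near=> h.
  have [->|h0] := eqVneq h 0.
    by rewrite add0r subrr mul0r subr0 normr0 mulr0.
  rewrite quotE// ler_wpM2r//.
  by move: (h0); near: h.
- move=> H.
  have lim : (fun h : K^o =>
      h^-1 *: ((F \o shift w) (h *: (1 : K^o)) - F w)) @ 0^' --> l.
    apply/cvgrPdist_le => e e0; have := H e e0 => He.
    near=> h.
    have h0 : h != 0 by near: h; exact: nbhs_dnbhs_neq.
    rewrite -(@ler_pM2r _ `|h|) ?normr_gt0// -quotE//.
    by near: h; exact: nbhs_dnbhs.
  by split; [apply/cvg_ex; exists l|exact: cvg_lim].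
Unshelve. all: by end_near. Qed.

(** * Modulus, compact squares and the mean value inequality *)

Section Cplx_topology.
Variable R : realType.
Implicit Types z w : Cplx R.

Lemma Re_norm z : `|z| = (complex.Re `|z|)%:C%C.
Proof. by case: z => a b. Qed.

Lemma gtC0_real (e : R[i]) : 0 < e -> exists2 d : R, 0 < d & e = d%:C%C.
Proof.
by case: e => a b; rewrite ltcE /= => /andP[/eqP -> a0]; exists a.
Qed.

Lemma normC_real (t : R) : `|t%:C%C : R[i]| = `|t|%:C%C.
Proof. by rewrite normc_def /= expr0n /= addr0 sqrtr_sqr. Qed.

Lemma normC_le_ReIm z :
  `|z| <= (`|complex.Re z| + `|complex.Im z|)%:C%C.
Proof.
rewrite {1}(complexE z) rmorphD/= (le_trans (ler_normD _ _))// normrM.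
have -> : `|'i%C : R[i]| = 1.
  by rewrite normc_def /= expr0n expr1n add0r sqrtr1.
by rewrite mul1r !normc_def /= expr0n /= !addr0 !sqrtr_sqr.
Qed.

Lemma ReIm_le_normC z :
  `|complex.Re z|%:C%C <= `|z| /\ `|complex.Im z|%:C%C <= `|z|.
Proof.
split; rewrite normc_def lecR -sqrtr_sqr ler_wsqrtr//.
  by rewrite lerDl sqr_ge0.
by rewrite lerDr sqr_ge0.
Qed.

Lemma continuous_modulus : continuous (fun z : Cplx R => complex.Re `|z| : R).
Proof.
move=> z; apply/(@cvgrPdist_lt _ R^o _ (nbhs z) _) => e e0.
near=> w; rewrite -raddfB -ltcR.
apply: (le_lt_trans (ReIm_le_normC _).1).
apply: (le_lt_trans (ler_dist_dist _ _)).
near: w; apply/(@nbhs_normP _ (Cplx R)).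
by exists e%:C%C => //=; rewrite ltcR.
Unshelve. all: by end_near. Qed.

(** Written as the image of a product of real segments, so that compactness is inherited from
    theirs. *)
Definition square (r : R) : set (Cplx R) :=
  (fun p : R * R => (p.1 +i* p.2)%C : Cplx R) @` (`[- r, r] `*` `[- r, r]).

Lemma squareP r z :
  square r z <-> `|complex.Re z| <= r /\ `|complex.Im z| <= r.
Proof.
split.
  by move=> [[a b] /= []]; rewrite !in_itv /= -!ler_norml => ? ? <-.
case: z => a b /= [ha hb]; exists (a, b) => //=.
by rewrite !in_itv /= -!ler_norml.
Qed.

Lemma compact_square r : compact (square r).
Proof.
apply: continuous_compact; last first.
  by apply: compact_setX; exact: segment_compact.
apply: continuous_subspaceT => -[a b].
apply/(@cvgrPdist_lt _ (Cplx R)) => _ /gtC0_real[e e0 ->].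
have e20 : 0 < e / 2 by rewrite divr_gt0.
near=> p.
apply: (le_lt_trans (normC_le_ReIm _)); rewrite ltcR [ltRHS]splitr /=.
rewrite ltrD//.
- near: p; apply: (@cvgr_dist_lt _ R^o _ (nbhs (a, b)) _ fst a) => //.
  exact: cvg_fst.
- near: p; apply: (@cvgr_dist_lt _ R^o _ (nbhs (a, b)) _ snd b) => //.
  exact: cvg_snd.
Unshelve. all: by end_near. Qed.

Lemma Cplx_hausdorff : hausdorff_space (Cplx R).
Proof. exact: norm_hausdorff. Qed.

Lemma bounded_normCP (T : Type) (A : set T) (f : T -> Cplx R) :
  [bounded f x | x in A] <->
  exists M : R, forall x, A x -> `|f x| <= M%:C%C.
Proof.
split=> [[M [Mr HM]]|[M HM]].
  have [m mE] : exists m, M = m%:C%C by exact/complex_realP.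
  (* [HM] bounds [f] by every number strictly above [m], hence by [m + 1]. *)
  by exists (m + 1) => x Ax; apply: HM => //; rewrite mE ltcR ltrDl.
exists M%:C%C; split; first by apply/complex_realP; exists M.
by move=> x xM y Ay /=; apply: le_trans (ltW xM); exact: HM.
Qed.

(** The modulus is comparable with the two coordinates. Boundedness thus becomes containment in one
    of countably many compact squares, which supplies both the countable intersection and the
    compactness used below. *)
Lemma bounded_square (T : Type) (A : set T) (f : T -> Cplx R) :
  [bounded f x | x in A] <-> exists n : nat, forall x, A x -> square n%:R (f x).
Proof.
rewrite bounded_normCP; split=> [[M HM]|[n Hn]].
- exists (Num.truncn M).+1 => x Ax; apply/squareP.
  have Mn := ltW (truncnS_gt M).
  have [h1 h2] := ReIm_le_normC (f x).
  by split; apply: le_trans Mn; rewrite -lecR;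
    [apply: le_trans h1 _|apply: le_trans h2 _]; exact: HM.
- exists (n%:R + n%:R) => x Ax; apply: (le_trans (normC_le_ReIm _)).
  by rewrite lecR; have /squareP[? ?] := Hn _ Ax; exact: lerD.
Qed.

(** With [u = F z - F w], the real part of [u^* F] increases by [|u|^2] along the segment from [w]
    to [z], while its derivative there is at most [|u| M |z - w|]. Dividing by [|u|] gives the
    bound. *)
Lemma mean_value_ineq (F f : Cplx R -> Cplx R) w z (M : R[i]) :
  (forall t : R, 0 <= t <= 1 ->
     is_derive (w + t%:C%C * (z - w)) (1 : Cplx R) F
               (f (w + t%:C%C * (z - w))) /\
     `|f (w + t%:C%C * (z - w))| <= M) ->
  `|F z - F w| <= M * `|z - w|.
Proof.
move=> H.
have [zw|zw] := eqVneq (F z - F w) 0.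
  rewrite zw normr0 mulr_ge0//.
  have [|_] := H 0; first by rewrite lexx ler01.
  exact: le_trans.
set u := F z - F w; set d := z - w.
(* The real mean value theorem applies to the component of F along u. *)
pose g (t : R) : Cplx R := w + t%:C%C * d.
pose phi (t : R) : R := complex.Re (u^*%C * F (g t)).
pose dphi (t : R) : R := complex.Re (u^*%C * (f (g t) * d)).
have dH (t : R) : 0 <= t <= 1 -> is_derive (t : R^o) (1 : R^o) phi (dphi t).
  move=> /H[/is_derive1_nearP Ht _].
  apply/(@is_derive1_nearP R) => e e0.
  (* Passing from [F] to [phi] multiplies the relative error by at most [|u| |d|]; the added 1 keeps
     the denominator positive. *)
  have k0 : 0 < (e%:C%C / (`|u| * `|d| + 1) : R[i]).
    by rewrite divr_gt0 ?ltcR// ltr_wpDl// mulr_ge0.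
  have cd : (fun s : R^o => (s%:C%C * d : Cplx R)) @ (0 : R^o) --> (0 : Cplx R).
    apply/cvgrPdist_lt => _ /gtC0_real[c c0 ->].
    have [|D D0 DE] := @gtC0_real (`|d| + 1); first by rewrite ltr_wpDl.
    near=> s; rewrite sub0r normrN normrM.
    have : `|s| < c / D.
      near: s; apply/nbhs_normP; exists (c / D) => /=; first by rewrite divr_gt0.
      by move=> s /=; rewrite sub0r normrN.
    rewrite ltr_pdivlMr// -ltcR rmorphM /= -DE; apply: le_lt_trans.
    by rewrite normC_real ler_wpM2l ?ler0c// lerDl.
  apply: (@filterS _ (nbhs (0 : R^o)) _ _ _ _ (cd _ (Ht _ k0))) => s /= Hs.
  have -> : phi (s + t) - phi t - s * dphi t =
      complex.Re (u^*%C * (F (s%:C%C * d + g t) - F (g t) - (s%:C%C * d) * f (g t))).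
    have alg (a b c v x r : R[i]) :
      v * a - v * b - r * (v * (c * x)) = v * (a - b - r * x * c) by ring.
    have gE : g (s + t) = s%:C%C * d + g t by rewrite /g rmorphD mulrDl addrCA.
    have sE (x : R[i]) : s * complex.Re x = complex.Re (s%:C%C * x).
      by case: x => x1 x2; rewrite /= mul0r subr0.
    rewrite /phi /dphi gE sE -!raddfB /=; congr complex.Re.
    exact: alg.
  rewrite -lecR; apply: (le_trans (ReIm_le_normC _).1).
  rewrite normrM normcJ.
  apply: (@le_trans _ _ (`|u| * ((e%:C)%C / (`|u| * `|d| + 1) * `|(s%:C)%C * d|))).
    by rewrite ler_wpM2l.
  rewrite normrM rmorphM /=.
  rewrite -normC_real.
  have -> : `|u| * ((e%:C)%C / (`|u| * `|d| + 1) * (`|(s%:C)%C| * `|d|)) =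
     (e%:C%C * `|s%:C%C|) * ((`|u| * `|d|) / (`|u| * `|d| + 1)).
    by ring.
  rewrite ler_piMr//; first by apply: mulr_ge0 => //; rewrite ler0c ltW.
  rewrite ler_pdivrMr ?mul1r ?lerDl//.
have [|||c c01] := @MVT_segment R phi dphi 0 1.
- exact: ler01.
- by move=> t; rewrite in_itv /= => /andP[/ltW t0 /ltW t1]; apply: dH; rewrite t0.
- apply: derivable_within_continuous => t; rewrite in_itv /= => t01.
  by have [] := dH t t01.
have g0 : g 0 = w by rewrite /g mul0r addr0.
have g1 : g 1 = z by rewrite /g mul1r addrC subrK.
rewrite /phi g0 g1 subr0 mulr1 -raddfB /= -mulrBr -/u => E.
have uE : u^*%C * u = `|u| ^+ 2 by rewrite sqr_normc mulrC.
have E2 : `|u| * `|u| = (dphi c)%:C%C.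
  by rewrite -E uE -expr2 -add_Re2_Im2.
have u0 : 0 < `|u| by rewrite normr_gt0.
rewrite -(ler_pM2l u0) E2.
apply: (@le_trans _ _ (`|dphi c|%:C%C)); first by rewrite lecR ler_norm.
apply: (le_trans (ReIm_le_normC _).1); rewrite !normrM normcJ ler_wpM2l// ler_wpM2r//.
by have [] := H c; rewrite -?in_itv//= in c01 *.
Unshelve. all: by end_near. Qed.

End Cplx_topology.

(** * Openness of Jordan domains *)

(** Each point of a disc inside [A] is joined to the centre by a segment, which is connected, so the
    disc stays in the component of its centre. *)
Lemma open_connected_component (R : realType) (A : set (Cplx R)) x :
  open A -> open (connected_component A x).
Proof.
move=> oA; rewrite openE => y Cy.
have Ay : A y := connected_component_sub Cy.
have /nbhs_normP[e e0 eA] : nbhs y A by exact: open_nbhs_nbhs.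
suff : nbhs y (connected_component A x) by [].
apply/(@nbhs_normP _ (Cplx R)); exists e => // u yu.
apply: connected_component_trans Cy _.
pose g (t : R) : Cplx R := y + t%:C%C * (u - y).
have gc : continuous g.
  move=> t; apply/(@cvgrPdist_lt _ (Cplx R)) => _ /gtC0_real[c c0 ->].
  have [|D D0 DE] := @gtC0_real _ (`|u - y| + 1); first by rewrite ltr_wpDl.
  near=> s; rewrite /g opprD addrACA subrr add0r -mulrBl -rmorphB normrM.
  have : `|t - s| < c / D.
    by near: s; apply/nbhs_normP; exists (c / D) => //=; rewrite divr_gt0.
  rewrite ltr_pdivlMr// -ltcR rmorphM /= -DE; apply: le_lt_trans.
  by rewrite normC_real ler_wpM2l ?ler0c// lerDl.
apply: (@connected_component_max _ A (g @` `[0, 1]) y).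
- by exists 0; rewrite /= ?in_itv /= ?lexx ?ler01// /g mul0r addr0.
- move=> _ [t + <-]; rewrite /= in_itv /= => /andP[t0 t1]; apply: eA => /=.
  rewrite /g opprD addrA subrr sub0r normrN normrM; move: yu => /=; rewrite distrC.
  apply: le_lt_trans; rewrite ler_piMl//.
  by rewrite normC_real (ger0_norm t0) -(rmorph1 (real_complex R)) lecR.
- apply: connected_continuous_connected; first exact: segment_connected.
  exact: continuous_subspaceT.
- exists 1; first by rewrite /= in_itv /= ler01 lexx.
  by rewrite /g mul1r addrC subrK.
Unshelve. all: by end_near. Qed.

Lemma jordan_domain_open (R : realType) (Omega : set (Cplx R)) :
  jordan_domain Omega -> open Omega.
Proof.
move=> [gamma [z [[gc _ _] _ -> _]]]; apply: open_connected_component.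
rewrite openC; apply: compact_closed; first exact: Cplx_hausdorff.
by apply: continuous_compact => //; exact: segment_compact.
Qed.

(** * Limits of antiderivatives along ultrafilters *)

(** Compactness gives a cluster point [p]. An ultrafilter contains either the preimage of a
    neighbourhood of [p] or its complement, and the complement would contradict clustering. *)
Lemma ultra_cvg_compact (I : Type) (T : topologicalType) (U : set_system I)
    (K : set T) (f : I -> T) : UltraFilter U -> compact K ->
  (\forall i \near U, K (f i)) -> exists2 p, K p & f @ U --> p.
Proof.
move=> UU cK UK; have [p [Kp clp]] := cK (f @ U) _ UK.
exists p => // V Vp.
have [//|UV] := in_ultra_setVsetC (f @^-1` V) UU.
by have [q []] := clp (~` V) V UV Vp.
Qed.

Section Antiderivatives.
Variables (R : realType) (Omega : set (Cplx R)).
Hypothesis openOmega : open Omega.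
Implicit Types f g F G : Cplx R -> Cplx R.

Lemma antiderivativeB f g F G : antiderivative Omega f F ->
  antiderivative Omega g G -> antiderivative Omega (f \- g) (F \- G).
Proof.
move=> [F0 dF] [G0 dG]; split; first by move=> z nz; rewrite /= F0// G0// subr0.
move=> z Oz; have ? := dF z Oz; have ? := dG z Oz.
exact: is_deriveB.
Qed.

Lemma antiderivativeZ (c : R[i]) f F : antiderivative Omega f F ->
  antiderivative Omega (fun z => c * f z) (fun z => c * F z).
Proof.
move=> [F0 dF]; split; first by move=> z nz; rewrite F0// mulr0.
by move=> z Oz; have ? := dF z Oz; exact: is_deriveZ.
Qed.

(** For [i] and [j] in a suitable member of [U], [G j - G i] has a uniformly small derivative, so
    its increments over [h] are small relative to [|h|], whatever [j] is. Letting [G j] approach the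
    limit [F], the first-order estimate of one fixed [G i] passes to [F]. *)
Lemma antiderivative_ultralimit (I : Type) (U : set_system I) r
    (g G : I -> Cplx R -> Cplx R) f : UltraFilter U ->
  (forall e : R[i], 0 < e -> \forall i \near U,
     forall z, Omega z -> `|f z - g i z| <= e) ->
  (\forall i \near U, antiderivative Omega (g i) (G i) /\
     forall z, Omega z -> square r (G i z)) ->
  exists2 F, antiderivative Omega f F & forall z, Omega z -> square r (F z).
Proof.
move=> UU gf gG.
have /choice[F HF] : forall z, exists l : Cplx R,
    (Omega z -> square r l /\ G^~ z @ U --> l) /\ (~ Omega z -> l = 0).
  move=> z; have [Oz|nOz] := pselect (Omega z); last by exists 0.
  have sqG : \forall i \near U, square r (G i z).
    by apply: filterS gG => i [_]; exact.
  have [l ? ?] := ultra_cvg_compact UU (@compact_square R r) sqG.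
  by exists l; split.
exists F; last by move=> z Oz; have [/(_ Oz)[]] := HF z.
split; first by move=> z nOz; have [_ /(_ nOz)] := HF z.
move=> w Ow; apply/(@is_derive1_nearP R[i]) => e e0.
(* The final decomposition costs six such shares: two for replacing [F] by [G j] at the two points,
   two for the mean value inequality, one for differentiating [G i], one for replacing [g i w] by
   [f w]. *)
have e6 : 0 < e / 6%:R by rewrite divr_gt0.
have [i [gfi [[Gi0 dGi] Gir]]] := filter_ex (filterI (gf _ e6) gG).
have /nbhs_normP[d d0 dO] : nbhs w Omega by exact: open_nbhs_nbhs.
have ballO (h : Cplx R) : `|h| < d -> Omega (h + w).
  by move=> hd; apply: dO; rewrite /= opprD addrCA subrr addr0 normrN.
have /is_derive1_nearP/(_ _ e6) Gi := dGi w Ow.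
have dn : \forall h \near (0 : Cplx R), `|h| < d.
  by apply/nbhs_normP; exists d => // h /=; rewrite sub0r normrN.
near=> h.
have hd : `|h| < d by near: h.
have [->|h0] := eqVneq h 0.
  by rewrite add0r subrr mul0r subr0 normr0 mulr0.
have eh : 0 < e / 6%:R * `|h| by rewrite mulr_gt0// normr_gt0.
have [/(_ Ow)[_ Fw] _] := HF w.
have [/(_ (ballO _ hd))[_ Fh] _] := HF (h + w).
have nFw : \forall j \near U, `|F w - G j w| <= e / 6%:R * `|h|.
  by move/cvgrPdist_le : Fw; apply.
have nFh : \forall j \near U, `|F (h + w) - G j (h + w)| <= e / 6%:R * `|h|.
  by move/cvgrPdist_le : Fh; apply.
(* The convergence of [G j] to [F] is only known pointwise, so [j] depends on [h]. This is harmless: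
   [i] and the disc were fixed before [h], and [j] does not occur in the conclusion. *)
have [j [[gfj [aGj _]] [Fwj Fhj]]] :=
  filter_ex (filterI (filterI (gf _ e6) gG) (filterI nFw nFh)).
have [_ dD] := antiderivativeB aGj (conj Gi0 dGi).
have mv : `|(G j \- G i) (h + w) - (G j \- G i) w|
    <= (e / 6%:R + e / 6%:R) * `|h|.
  have := @mean_value_ineq R (G j \- G i) (g j \- g i) w (h + w)
    (e / 6%:R + e / 6%:R).
  rewrite addrK; apply => t /andP[t0 t1].
  have Ot : Omega (w + t%:C%C * h).
    rewrite addrC; apply: ballO; rewrite normrM normC_real (ger0_norm t0).
    by apply: le_lt_trans hd; rewrite ler_piMl// -(rmorph1 (real_complex R)) lecR.
  split; first exact: dD.
  rewrite /= -[X in `|X|](subrKA (f (w + t%:C%C * h))).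
  apply: (le_trans (ler_normD _ _)); rewrite lerD// ?gfi// distrC; exact: gfj.
have -> : F (h + w) - F w - h * f w =
    (F (h + w) - G j (h + w)) - (F w - G j w) +
    ((G j \- G i) (h + w) - (G j \- G i) w) +
    (G i (h + w) - G i w - h * g i w) - h * (f w - g i w).
  have alg (a b c p q s t u x : R[i]) : a - b - x * c =
    a - s - (b - t) + ((s - p) - (t - q)) + (p - q - x * u) - x * (c - u) by ring.
  exact: alg.
have -> : e * `|h| = e / 6%:R * `|h| + e / 6%:R * `|h| +
    (e / 6%:R + e / 6%:R) * `|h| + e / 6%:R * `|h| + e / 6%:R * `|h| by field.
apply: (le_trans (ler_normB _ _)); apply: lerD.
  apply: (le_trans (ler_normD _ _)); apply: lerD.
    apply: (le_trans (ler_normD _ _)); apply: lerD => //.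
    by apply: (le_trans (ler_normB _ _)); exact: lerD.
  by near: h.
by rewrite normrM mulrC ler_wpM2r// gfi.
Unshelve. all: by end_near. Qed.

(** * The G-delta property and density in a space of functions *)

Definition bounded_antiderivative (n : nat) f :=
  exists2 F, antiderivative Omega f F &
    forall z, Omega z -> square n%:R (F z).

Section Subspace.
Variable S : set {uniform` Omega -> Cplx R}.

(** Common form of [X1], for [S = Abar Omega], and of [X3], for [S = Hinfty Omega]. *)
Definition without_bounded_antiderivative : set (set_type S) :=
  [set f | forall F, antiderivative Omega (set_val f) F -> ~ Hinfty Omega F].

Lemma near_uniform (f : set_type S) (e : R[i]) : 0 < e ->
  \forall g \near f, forall z, Omega z ->
    `|(set_val f : Cplx R -> Cplx R) z - (set_val g : Cplx R -> Cplx R) z| <= e.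
Proof.
move=> /gtC0_real[d d0 ->]; apply/nbhs_supnorm; exists d => // g fg z Oz.
rewrite distrC Re_norm lecR -lee_fin; apply: le_trans (ltW fg).
by apply: ereal_sup_ubound; exists z.
Qed.

Lemma closed_bounded_antiderivative n :
  closed [set f : set_type S | bounded_antiderivative n (set_val f)].
Proof.
move=> f clf; set C := [set f | _] in clf.
(* As [f] lies in the closure of [C], its neighbourhoods trace a proper filter on [C]; an
   ultrafilter refining it contains [C] and converges to [f]. *)
have PF : ProperFilter (within C (nbhs f)).
  exact: within_nbhs_proper.
have [U [UU nU]] := ultraFilterLemma PF.
have /choice[G HG] : forall g : set_type S, exists G, C g ->
    antiderivative Omega (set_val g) G /\ forall z, Omega z -> square n%:R (G z).
  move=> g; have [[G ? ?]|nC] := pselect (C g); first by exists G.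
  (* A default outside [C], invisible in the limit because [U] contains [C]. *)
  by exists 0.
apply: (@antiderivative_ultralimit (set_type S) U n%:R set_val G) => //.
- move=> e e0; apply: nU; rewrite /within /=.
  by apply: filterS (near_uniform f e0) => g.
- by apply: nU; rewrite /within /=; apply: filterE => g; exact: HG.
Qed.

Lemma without_bounded_antiderivativeE :
  without_bounded_antiderivative =
  \bigcap_n ~` [set f : set_type S | bounded_antiderivative n (set_val f)].
Proof.
apply/seteqP; split=> f fX.
- move=> n _ [F aF Fn]; apply: (fX F aF); split; first exact: aF.1.
    by move=> z Oz; have [] := aF.2 z Oz.
  by apply/bounded_square; exists n.
- move=> F aF [_ _ /bounded_square[n Fn]].
  by apply: (fX n) => //; exists F.
Qed.

Lemma Gdelta_without_bounded_antiderivative :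
  Gdelta without_bounded_antiderivative.
Proof.
eexists; last exact: without_bounded_antiderivativeE.
by move=> n; rewrite openC; exact: closed_bounded_antiderivative.
Qed.

Hypothesis S_bounded : S `<=` Hinfty Omega.
Hypothesis S_linear : forall (c : R[i]) f g, S f -> S g ->
  S (fun z => f z + c * g z).

Lemma dense_without_bounded_antiderivative :
  without_bounded_antiderivative !=set0 ->
  dense without_bounded_antiderivative.
Proof.
move=> [f0 f0X] O [f Of] oO.
have [fX|] := pselect (without_bounded_antiderivative f); first by exists f.
move=> /existsNP[F /not_implyP[aF /contrapT [_ _ bF]]].
have /nbhs_supnorm[e e0 eO] : nbhs f O by exact: open_nbhs_nbhs.
have Sf0 : S (set_val f0) := set_valP f0.
have Sf : S (set_val f) := set_valP f.
have [_ _ /bounded_normCP[M f0M]] := S_bounded Sf0.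
(* Chosen so that [|c f0| <= e / 2 < e] on [Omega], which keeps [f + c f0] in [O]. *)
pose c : R := e / 2 / (`|M| + 1).
have M0 : 0 < `|M| + 1 by rewrite ltr_wpDl.
have c0 : 0 < c by rewrite divr_gt0// divr_gt0.
have c0' : c%:C%C != 0 :> R[i] by rewrite gt_eqF// ltcR.
have Sg := S_linear c%:C%C Sf Sf0.
exists (SigSub (mem_set Sg)).
split.
- apply: eO; apply: (@le_lt_trans _ _ (e / 2)%:E); last first.
    by rewrite lte_fin gtr_pMr// invf_lt1// ltr1n.
  apply: ge_ereal_sup => _ [z Oz <-]; rewrite lee_fin -lecR -Re_norm.
  rewrite addrAC subrr add0r normrM normC_real (gtr0_norm c0).
  apply: (@le_trans _ _ (c%:C%C * M%:C%C)).
    by rewrite ler_wpM2l ?f0M// ler0c ltW.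
  rewrite -rmorphM lecR /c mulrAC ler_pdivrMr// ler_wpM2l ?divr_ge0 ?(ltW e0)//.
  by rewrite (le_trans (ler_norm _))// lerDl.
- move=> G aG [_ _ bG].
  (* If [G] were a bounded antiderivative of [f + c f0], then [(G - F) / c] would be one of [f0],
     contradicting the choice of [f0]. *)
  have af0 : antiderivative Omega (set_val f0) (fun z => c%:C%C^-1 * (G z - F z)).
    have := antiderivativeZ c%:C%C^-1 (antiderivativeB aG aF).
    congr antiderivative; apply/funext => z /=.
    by rewrite addrAC subrr add0r mulKf.
  apply: (f0X _ af0); split; first exact: af0.1.
    by move=> z Oz; have [] := af0.2 z Oz.
  move: bF bG => /bounded_normCP[p Fp] /bounded_normCP[q Gq].
  have [r0 rE] : exists r0 : R, `|c%:C%C^-1 : R[i]| = r0%:C%C.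
    by eexists; exact: Re_norm.
  apply/bounded_normCP; exists (r0 * (q + p)) => z Oz.
  rewrite normrM rE rmorphM /= -rE ler_wpM2l// (le_trans (ler_normB _ _))//.
  by rewrite rmorphD lerD ?Fp ?Gq.
Qed.

End Subspace.

(** * Application to [Abar] and [Hinfty] *)

Lemma Hinfty_linear (c : R[i]) f g : Hinfty Omega f -> Hinfty Omega g ->
  Hinfty Omega (fun z => f z + c * g z).
Proof.
move=> [f0 df /bounded_normCP[M fM]] [g0 dg /bounded_normCP[N gN]]; split.
- by move=> z nOz; rewrite f0// g0// mulr0 addr0.
- by move=> z Oz; apply: derivableD; [exact: df|apply: derivableZ; exact: dg].
- have [r rE] : exists r : R, `|c| = r%:C%C by eexists; exact: Re_norm.
  apply/bounded_normCP; exists (M + r * N) => z Oz.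
  rewrite (le_trans (ler_normD _ _))// rmorphD rmorphM /= -rE normrM.
  by rewrite lerD ?fM// ler_wpM2l ?gN.
Qed.

Lemma Abar_linear (c : R[i]) f g : Abar Omega f -> Abar Omega g ->
  Abar Omega (fun z => f z + c * g z).
Proof.
move=> [f0 df [u uc uf]] [g0 dg [v vc vg]]; split.
- by move=> z nOz; rewrite f0// g0// mulr0 addr0.
- by move=> z Oz; apply: derivableD; [exact: df|apply: derivableZ; exact: dg].
- exists (fun z => u z + c * v z); last by move=> z Oz; rewrite uf// vg.
  move=> z; apply: cvgD; first exact: uc.
  by apply: cvgM; [exact: cvg_cst|exact: vc].
Qed.

Lemma Abar_sub_Hinfty : bounded_set Omega -> Abar Omega `<=` Hinfty Omega.
Proof.
move=> bO f [f0 df [u uc uf]]; split=> //.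
have /bounded_square[n On] : [bounded (z : Cplx R) | z in Omega] := bO.
(* A bounded [Omega] lies in a compact, hence closed, square, which therefore contains its
   closure. *)
have cO : compact (closure Omega).
  apply: (subclosed_compact _ (@compact_square R n%:R)).
    exact: closed_closure.
  rewrite closureE => z; apply; split=> //.
  by apply: compact_closed; [exact: Cplx_hausdorff|exact: compact_square].
(* The continuous extension [u] is bounded through its real-valued modulus, whose image of the
   compact closure is compact in [R]. *)
have [M [Mr HM]] : bounded_set
    ((fun z => complex.Re `|u z| : R^o) @` closure Omega).
  apply: compact_bounded; apply: continuous_compact => //.
  by move=> z; apply: (cvg_comp u _ (uc z)); exact: continuous_modulus.
apply/bounded_normCP; exists (M + 1) => z Oz; rewrite Re_norm lecR -uf//.
apply: (le_trans (ler_norm _)); apply: HM; first by rewrite ltrDl.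
by exists z => //; exact: subset_closure.
Qed.

End Antiderivatives.

Theorem proposition7p1 (R : realType) (Omega : set (Cplx R))
    (hOmega : jordan_domain Omega) :
  (X1 Omega !=set0 ->
     [/\ dense (X1 Omega), Gdelta (X1 Omega) & residual (X2 Omega)]) /\
  (X3 Omega !=set0 ->
     [/\ dense (X3 Omega), Gdelta (X3 Omega) & residual (X4 Omega)]).
Proof.
have oO := jordan_domain_open hOmega.
have AH : Abar Omega `<=` Hinfty Omega.
  by apply: Abar_sub_Hinfty; case: hOmega => gamma [z []].
split=> X0.
- have dX : dense (X1 Omega).
    by apply: dense_without_bounded_antiderivative X0 => //; exact: Abar_linear.
  have GX : Gdelta (X1 Omega) by exact: Gdelta_without_bounded_antiderivative.
  (* [X1] itself is the dense G-delta inside [X2]: by [AH], an antiderivative in [Abar] would be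
     bounded. *)
  split=> //; exists (X1 Omega); split=> // f fX F aF /AH.
  exact: fX.
- have dX : dense (X3 Omega).
    by apply: dense_without_bounded_antiderivative X0 => //; exact: Hinfty_linear.
  have GX : Gdelta (X3 Omega) by exact: Gdelta_without_bounded_antiderivative.
  split=> //; exists (X3 Omega); split=> // f fX F aF /AH.
  exact: fX.
Qed.
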